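(* There is an absolute constant $\delta>0$ (one can choose $\delta=0.195$) such that if $Z=(z_{ij})$ is a complex $n\times n$ matrix satisfying $|z_{ij}-1|\le\delta$ for all $i,j$, then $\operatorname{per} Z\ne 0$.
   Context: The permanent of an $n\times n$ matrix $Z=(z_{ij})$ is $\operatorname{per} Z=\sum_{\sigma\in S_n}\prod_{i=1}^n z_{i\sigma(i)}$, where $S_n$ is the symmetric group on $\{1,\dots,n\}$. *)

(* Defs.v *)
From HB Require Import structures.
From mathcomp Require Import all_boot all_order all_algebra all_fingroup.

Set Implicit Arguments.
Unset Strict Implicit.
Unset Printing Implicit Defensive.

Import GRing.Theory.
Local Open Scope ring_scope.

Definition permanent (R : comPzSemiRingType) (n : nat) (Z : 'M[R]_n) : R :=
  \sum_(s : 'S_n) \prod_(i < n) Z i (s i).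

(* Main.v *)
Require Import Defs.
From HB Require Import structures.
From mathcomp Require Import all_boot all_order all_algebra all_fingroup.
From mathcomp Require Import complex.
From mathcomp Require Import reals.
From mathcomp Require Import ring lra.

Set Implicit Arguments.
Unset Strict Implicit.
Unset Printing Implicit Defensive.

Import Order.TTheory GRing.Theory Num.Theory.
Local Open Scope ring_scope.
Local Open Scope complex_scope.

(* By induction on n, permanents of two matrices with entries close to 1 that
   differ in a single row make an acute angle (positive real inner product).
   Expand both along that row: the cofactors u_j are common to both, and two of
   them come from minors which, up to a permutation of columns, differ in a
   single column, so the u_j pairwise make acute angles. Hence
   \sum_j |u_j| <= 2 |T| with T = \sum_j u_j != 0, both permanents lie within
   2 delta |T| of T, and they make an acute angle as soon as
   2 (2 delta) + (2 delta)^2 < 1. *)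

(** * Symmetries of the permanent and expansion along a row *)

Section Permanent.

Variable R : comPzSemiRingType.

Lemma permanent_tr (n : nat) (A : 'M[R]_n) : permanent A^T = permanent A.
Proof.
rewrite /permanent (reindex_inj invg_inj); apply: eq_bigr => s _ /=.
rewrite (reindex_inj (@perm_inj _ s)); apply: eq_bigr => i _ /=.
by rewrite permK mxE.
Qed.

Lemma permanent_row_perm (n : nat) (s : 'S_n) (A : 'M[R]_n) :
  permanent (row_perm s A) = permanent A.
Proof.
rewrite /permanent (reindex_inj (mulgI s)); apply: eq_bigr => t _ /=.
rewrite [RHS](reindex_inj (@perm_inj _ s)); apply: eq_bigr => i _ /=.
by rewrite permM mxE.
Qed.

(** Injectivity suffices, since both sides have (n+1)! elements; this reindexes the row expansion by
    the image of [i]. *)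
Lemma lift_perm_bij (n : nat) (i : 'I_n.+1) :
  bijective (fun p : 'I_n.+1 * 'S_n => lift_perm i p.1 p.2).
Proof.
apply: inj_card_bij => [[j s] [k t] /= /permP e|].
  have := e i; rewrite !lift_perm_id => ejk; rewrite -{}ejk in e *.
  congr pair; apply/permP => l; have := e (lift i l).
  by rewrite !lift_perm_lift => /lift_inj.
by rewrite card_prod !card_Sn card_ord factS.
Qed.

Lemma expand_permanent_row (n : nat) (A : 'M[R]_n.+1) (i : 'I_n.+1) :
  permanent A = \sum_j A i j * permanent (row' i (col' j A)).
Proof.
under eq_bigr do rewrite /permanent mulr_sumr.
rewrite pair_big /permanent (reindex _ (onW_bij _ (lift_perm_bij i))) /=.
apply: eq_bigr => -[j s] _ /=.
rewrite (bigD1_ord i) //= lift_perm_id; congr (_ * _).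
by apply: eq_bigr => k _; rewrite lift_perm_lift !mxE.
Qed.

(** The right-hand matrix has the columns of [col' k A] in another order, chosen so that it differs
    from [col' j A] only where column [k] is replaced by column [j]. *)
Lemma permanent_col'_tperm (n : nat) (A : 'M[R]_(n, n.+1)) (j k : 'I_n.+1) :
  permanent (col' k A) = permanent (colsub (tperm j k \o lift j) A).
Proof.
(* The default [l] is never reached: [tperm j k] sends only [j] to [k], and [lift j l] is not
   [j]. *)
pose g l := odflt l (unlift k (tperm j k (lift j l))).
have gE l : lift k (g l) = tperm j k (lift j l).
  rewrite /g; case: unliftP => [m -> //|] /(canRL (tpermK j k)).
  by rewrite tpermR => /eqP; rewrite eq_sym (negPf (neq_lift j l)).
have g_inj : injective g.
  by move=> l m /(congr1 (lift k)); rewrite !gE => /perm_inj/lift_inj.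
rewrite -permanent_tr -(permanent_row_perm (perm g_inj)).
rewrite -[RHS]permanent_tr; congr permanent; apply/matrixP => l m.
by rewrite !mxE permE gE.
Qed.

End Permanent.

(** * Complex numbers as vectors of the real plane *)

Section PlaneVectors.

Variable R : rcfType.
Implicit Types u v w : R[i].

(** This is the real part of [u] times the conjugate of [v]; it is positive exactly when the angle
    is acute. *)
Definition cdot u v : R :=
  complex.Re u * complex.Re v + complex.Im u * complex.Im v.

Local Notation normc := ComplexField.Normc.normc.

Lemma normc_ge0 u : 0 <= normc u.
Proof. by case: u => a b; apply: sqrtr_ge0. Qed.

Lemma sqr_normc_cdot u : normc u ^+ 2 = cdot u u.
Proof. by case: u => a b; rewrite sqr_sqrtr ?addr_ge0 ?sqr_ge0 // !expr2. Qed.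

Lemma cdotC u v : cdot u v = cdot v u.
Proof. by rewrite /cdot mulrC [X in _ + X]mulrC. Qed.

Lemma cdotDl u v w : cdot (u + v) w = cdot u w + cdot v w.
Proof. by case: u v w => [a b] [c d] [e f]; rewrite /cdot /=; ring. Qed.

Lemma cdotDr u v w : cdot w (u + v) = cdot w u + cdot w v.
Proof. by rewrite cdotC cdotDl !(cdotC w). Qed.

Lemma cdot_sumr (I : finType) (F : I -> R[i]) w :
  cdot w (\sum_i F i) = \sum_i cdot w (F i).
Proof.
apply: (big_morph (cdot w)) => [u v|]; first exact: cdotDr.
by rewrite /cdot /= !mulr0 addr0.
Qed.

Lemma ler_norm_cdot u v : `|cdot u v| <= normc u * normc v.
Proof.
rewrite -ler_sqr ?nnegrE ?mulr_ge0 ?normc_ge0 // exprMn !sqr_normc_cdot.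
rewrite real_normK ?num_real //.
case: u v => [a b] [c d]; rewrite /cdot /= -subr_ge0.
(* Lagrange's identity, which gives Cauchy-Schwarz. *)
have -> : (a * a + b * b) * (c * c + d * d) - (a * c + b * d) ^+ 2 =
    (a * d - b * c) ^+ 2 by ring.
exact: sqr_ge0.
Qed.

Lemma normc_sum (I : finType) (F : I -> R[i]) :
  normc (\sum_i F i) <= \sum_i normc (F i).
Proof.
elim/big_rec2: _ => [|i x u _ le_ux].
  by rewrite ComplexField.Normc.normc0.
by apply: le_trans (le_normcD _ _) _; rewrite lerD2l.
Qed.

(* With h and -h the sums of the positive and negative y's, and a, b the sums of
   the corresponding x's, summing the hypothesis over pairs of opposite signs
   gives h^2 <= a b. *)
Lemma ler_sum_abs_balanced (I : finType) (x y : I -> R) :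
  (forall i, 0 <= x i) -> \sum_i y i = 0 ->
  (forall i j, 0 <= x i * x j + y i * y j) ->
  \sum_i `|y i| <= \sum_i x i.
Proof.
move=> x0 sy xy.
pose P i := 0 <= y i.
have hxy : 0 <= \sum_(i | P i) \sum_(j | ~~ P j) (x i * x j + y i * y j).
  by apply: sumr_ge0 => i _; apply: sumr_ge0 => j _.
have e : \sum_(i | P i) \sum_(j | ~~ P j) (x i * x j + y i * y j) =
    (\sum_(i | P i) x i) * (\sum_(j | ~~ P j) x j) +
    (\sum_(i | P i) y i) * (\sum_(j | ~~ P j) y j).
  rewrite !mulr_suml -big_split; apply: eq_bigr => i _ /=.
  by rewrite !mulr_sumr -big_split.
move: sy hxy; rewrite {}e !(bigID P predT) /=.
have -> : \sum_(i | P i) `|y i| = \sum_(i | P i) y i.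
  by apply: eq_bigr => i Pi; rewrite ger0_norm.
have -> : \sum_(i | ~~ P i) `|y i| = - \sum_(i | ~~ P i) y i.
  by rewrite -sumrN; apply: eq_bigr => i; rewrite -ltNge => /ltr0_norm.
have : 0 <= \sum_(i | P i) y i by apply: sumr_ge0.
have : 0 <= \sum_(i | P i) x i by apply: sumr_ge0.
have : 0 <= \sum_(i | ~~ P i) x i by apply: sumr_ge0.
move: (\sum_(i | P i) x i) (\sum_(i | ~~ P i) x i) => a b.
move: (\sum_(i | P i) y i) (\sum_(i | ~~ P i) y i) => h k b0 a0 h0 hk.
have -> : k = - h by lra.
rewrite opprK mulrN => hab.
rewrite -ler_sqr ?nnegrE ?addr_ge0 //.
(* 4 h^2 <= 4 a b <= (a + b)^2. *)
have := sqr_ge0 (a - b); nra.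
Qed.

(* The u i are resolved into components along and across T = \sum_i u i. *)
Lemma sum_normc_le (I : finType) (u : I -> R[i]) :
  (forall i j, 0 <= cdot (u i) (u j)) ->
  \sum_i normc (u i) <= 2 * normc (\sum_i u i).
Proof.
move=> u0; set T := \sum_i u i.
have uT i : normc (u i) ^+ 2 <= cdot (u i) T.
  rewrite cdot_sumr (bigD1 i) //= sqr_normc_cdot lerDl.
  by apply: sumr_ge0 => j _.
have [T0|T0] := eqVneq (normc T) 0.
  rewrite T0 mulr0 big1 // => i _; apply/eqP; rewrite -sqrf_eq0.
  rewrite eq_le sqr_ge0 andbT; apply: le_trans (uT i) _.
  have := ler_norm_cdot (u i) T; rewrite T0 mulr0.
  by apply: le_trans (ler_norm _).
have Tgt0 : 0 < normc T by rewrite lt_neqAle eq_sym T0 normc_ge0.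
pose x i := cdot (u i) T; pose y i := cdot (u i) (T * 'i).
have x0 i : 0 <= x i by apply: le_trans (uT i); apply: sqr_ge0.
have xy i j : x i * x j + y i * y j = normc T ^+ 2 * cdot (u i) (u j).
  rewrite sqr_normc_cdot /x /y.
  by case: (u i) (u j) (T) => [a b] [c d] [e f]; rewrite /cdot /=; ring.
have sx : \sum_i x i = normc T ^+ 2.
  under eq_bigr do rewrite /x cdotC.
  by rewrite -cdot_sumr sqr_normc_cdot.
have sy : \sum_i y i = 0.
  under eq_bigr do rewrite /y cdotC.
  rewrite -cdot_sumr -/T.
  by case: (T) => a b; rewrite /cdot /=; ring.
have hy : \sum_i `|y i| <= normc T ^+ 2.
  rewrite -sx; apply: ler_sum_abs_balanced => // i j.
  by rewrite xy mulr_ge0 ?sqr_ge0.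
(* By [xy] with j = i, the left side squared is x_i^2 + y_i^2. *)
have hu i : normc T * normc (u i) <= x i + `|y i|.
  have xy0 : 0 <= x i + `|y i| by apply: addr_ge0.
  rewrite -ler_sqr ?nnegrE ?mulr_ge0 ?normc_ge0 //.
  rewrite exprMn (sqr_normc_cdot (u i)) -xy.
  have := real_normK (num_real (y i)).
  have := mulr_ge0 (x0 i) (normr_ge0 (y i)).
  nra.
rewrite -(ler_pM2l Tgt0) mulr_sumr.
apply: le_trans (ler_sum _ (fun i _ => hu i)) _.
by rewrite big_split /= sx; nra.
Qed.

(** * Perturbation estimates and the induction on the size *)

Lemma normc_sum_perturb (I : finType) (d : R) (a u : I -> R[i]) :
  (forall i, normc (a i - 1) <= d) ->
  normc (\sum_i a i * u i - \sum_i u i) <= d * \sum_i normc (u i).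
Proof.
move=> ad; rewrite -sumrB mulr_sumr; apply: le_trans (normc_sum _) _.
apply: ler_sum => i _.
rewrite -{2}[u i]mul1r -mulrBl.
by rewrite ComplexField.Normc.normcM ler_wpM2r ?normc_ge0.
Qed.

(** Writing v = T + a and w = T + b, Cauchy-Schwarz bounds the inner product below by (1 - 2 e -
    e^2) |T|^2. *)
Lemma cdot_perturb_gt0 (e : R) (T v w : R[i]) :
  T != 0 -> 2 * e + e ^+ 2 < 1 ->
  normc (v - T) <= e * normc T -> normc (w - T) <= e * normc T ->
  0 < cdot v w.
Proof.
move=> T0 he hv hw.
have Tgt0 : 0 < normc T.
  rewrite lt_neqAle normc_ge0 andbT eq_sym; apply: contraNneq T0.
  by move/ComplexField.Normc.eq0_normc ->.
rewrite -(subrK T v) -(subrK T w); move: (v - T) (w - T) hv hw => a b ha hb.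
rewrite !cdotDl !cdotDr -sqr_normc_cdot.
have := ler_norm_cdot a b; have := ler_norm_cdot a T; have := ler_norm_cdot T b.
rewrite !ler_norml => /andP[h1 _] /andP[h2 _] /andP[h3 _].
have a0 := normc_ge0 a; have b0 := normc_ge0 b.
have h4 : normc a * normc T <= e * normc T ^+ 2 by nra.
have h5 : normc T * normc b <= e * normc T ^+ 2 by nra.
have h6 : normc a * normc b <= e ^+ 2 * normc T ^+ 2.
  by rewrite -exprMn expr2 ler_pM.
have : 0 < (1 - (2 * e + e ^+ 2)) * normc T ^+ 2.
  by rewrite mulr_gt0 ?exprn_gt0 ?subr_gt0.
nra.
Qed.

(* [r] is a natural number rather than an ordinal so that the case [n = 0] is
   covered. *)
Lemma cdot_permanent_gt0 (d : R) (n : nat) (r : nat) (A B : 'M[R[i]]_n) :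
  0 <= d -> d <= 1 / 5 ->
  (forall i j, normc (A i j - 1) <= d) ->
  (forall i j, normc (B i j - 1) <= d) ->
  (forall i j : 'I_n, i != r :> nat -> A i j = B i j) ->
  0 < cdot (permanent A) (permanent B).
Proof.
move=> d0 d5; elim: n r A B => [|n IHn] r A B hA hB AB.
  rewrite /permanent.
  suff E (C : 'M[R[i]]_0) : \sum_(s : 'S_0) \prod_i C i (s i) = 1.
    by rewrite !E /cdot /=; lra.
  under eq_bigr do rewrite big_ord0.
  by rewrite sumr_const card_Sn.
(* If [r] is out of range, [A] and [B] agree everywhere and any row will do. *)
pose i0 : 'I_n.+1 := inord r.
have {}AB i j : i != i0 -> A i j = B i j.
  move=> ii0; apply: AB; apply: contraNneq ii0 => ir.
  by rewrite /i0 -ir inord_val.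
pose u j := permanent (row' i0 (col' j A)).
have uB j : permanent (row' i0 (col' j B)) = u j.
  congr permanent; apply/matrixP => i k; rewrite !mxE AB //.
  by rewrite eq_sym neq_lift.
have ugt0 j k : 0 < cdot (u j) (u k).
  have rowcol l : row' i0 (col' l A) = col' l (row' i0 A).
    by apply/matrixP => i m; rewrite !mxE.
  rewrite /u !rowcol (permanent_col'_tperm _ j k) -permanent_tr.
  rewrite -[permanent (colsub _ _)]permanent_tr.
  (* After transposition the minors differ only in the row coming from column [k]. If j = k they
     coincide, and the out-of-range default [n] expresses this. *)
  apply: (IHn (oapp (@nat_of_ord n) n (unlift j k))) => [l m|l m|l m];
    rewrite ?mxE //.
  move=> lr; congr (A _ _) => /=; rewrite tpermD ?neq_lift //.
  by apply: contraNneq lr => ->; rewrite liftK.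
have T0 : \sum_j u j != 0.
  (* The inner product of T with [u ord0] is a sum of positive terms. *)
  apply/eqP => T0; have := cdot_sumr u (u ord0).
  rewrite T0 {1}/cdot /= !mulr0 addr0 => /esym/eqP; apply/negP.
  rewrite gt_eqF // big_ord_recl ltr_pwDl //.
  by apply: sumr_ge0 => j _; apply: ltW.
have perturb (C : 'M_n.+1) : (forall j, normc (C i0 j - 1) <= d) ->
    normc (\sum_j C i0 j * u j - \sum_j u j) <= d * 2 * normc (\sum_j u j).
  move=> hC; apply: le_trans (normc_sum_perturb _ hC) _.
  rewrite -mulrA ler_wpM2l // sum_normc_le // => j k; exact: ltW.
rewrite (expand_permanent_row A i0) (expand_permanent_row B i0).
under [X in cdot _ X]eq_bigr do rewrite uB.
(* Here e = 2 d <= 2/5, so 2 e + e^2 <= 24/25. *)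
by apply: (cdot_perturb_gt0 T0 _ (perturb _ _) (perturb _ _)) => //; nra.
Qed.

End PlaneVectors.

Theorem theorem1p3 (R : realType) :
  exists delta : R, [/\ 0 < delta, delta = 195 / 1000 &
    forall (n : nat) (Z : 'M[R[i]]_n),
      (forall i j : 'I_n, `|Z i j - 1| <= delta%:C) -> permanent Z <> 0].
Proof.
exists (195 / 1000); split => [||n Z hZ perZ]; [lra|by []|].
have hZ' i j : ComplexField.Normc.normc (Z i j - 1) <= 195 / 1000.
  by rewrite -lecR; apply: hZ.
(* With both matrices equal to [Z], the squared modulus of the permanent is positive; the row 0 is
   arbitrary. *)
have := @cdot_permanent_gt0 R (195 / 1000) n 0 Z Z.
rewrite perZ /cdot /= !mulr0 addr0 ltxx => h.
by suff : false by []; apply: h => //; lra.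
Qed.
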